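(* Let $G$ be a Dyck graph on $\{1,\dots,n\}$ and let $u$ be a packed word of length $n$. The coefficient of $\mathbf{M}_u$ in $\mathbf{LLT}_G(A(q-1))$ is $$t^{\mathrm{asc}_G(u)}\prod_{i=1}^{\max(u)}\mathrm{LLT}_{G_i(u)}(q-1).$$
   Context: A Dyck graph is a simple graph on $\{1,\dots,n\}$ such that whenever $\{i,j\}$ with $i<j$ is an edge, all $\{i',j'\}$ with $i\le i'<j'\le j$ are edges. A word $u$ over the positive integers is packed if the set of its letters is $\{1,\dots,r\}$, $r=\max(u)$; it encodes the set composition $(u^{-1}(1),\dots,u^{-1}(r))$ of the set of positions, $u^{-1}(i)=\{k:u_k=i\}$. For packed words of the same length, $v\le u$ means that the set composition of $v$ is obtained from that of $u$ by merging adjacent blocks. $u|_S$ is the subword of $u$ at the positions in $S$. The evaluation $\mathrm{ev}(w)$ of a word is the composition recording the multiplicities of its distinct letters in increasing order of the letters. $\mathbf{WQSym}$ is the algebra of quasi-symmetric functions in noncommuting variables, with basis $\mathbf{M}_u=\sum_{\mathrm{pack}(w)=u}w$ ($u$ packed; $\mathrm{pack}(w)$ replaces the letters of $w$ by $1,2,\dots$ in an order-preserving way); $M_I$ is the monomial basis of $QSym$. For a word $w$ of length $n$, $\mathrm{asc}_G(w)$ is the number of edges $\{i,j\}$ of $G$ with $i<j$ and $w_i<w_j$, and $G_i(w)$ is the subgraph of $G$ induced on $\{k:w_k=i\}$, relabelled in an order-preserving way. The unicellular LLT polynomial and its noncommutative version are $$\mathrm{LLT}_G=\sum_{w}t^{\mathrm{asc}_G(w)}M_{\mathrm{ev}(w)}\in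 QSym,\qquad \mathbf{LLT}_G(A;t)=\sum_{w}t^{\mathrm{asc}_G(w)}\mathbf{M}_w\in\mathbf{WQSym},$$ both sums being over all packed words $w$ of length $n$ (for Dyck graphs, $\mathrm{LLT}_G$ is a symmetric function). Evaluation at $q-1$: $f\mapsto f(q-1)$ is the ring morphism on $QSym$ defined by $M_I(q-1)=(-1)^{\ell-1}(q^{i_1}-1)$ for a nonempty composition $I=(i_1,\dots,i_\ell)$ (on symmetric functions it is $p_k\mapsto q^k-1$). The transform $A\mapsto A(q-1)$ of $\mathbf{WQSym}$ is the linear map $$\mathbf{M}_u(A(q-1))=\sum_{v\le u}\Big(\prod_{i=1}^{\max(v)}M_{\mathrm{ev}(u|_{v^{-1}(i)})}(q-1)\Big)\mathbf{M}_v(A).$$ *)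

(* Defs.v *)
From HB Require Import structures.
From mathcomp Require Import all_boot all_order all_algebra.
From mathcomp Require Export freeg.

Set Implicit Arguments.
Unset Strict Implicit.
Unset Printing Implicit Defensive.

Import GRing.Theory.
Local Open Scope ring_scope.

(* The vertices (and the positions in a word) 1, ..., n are shifted to the
   elements 0, ..., n-1 of ['I_n]. *)

Definition dyck_graph (n : nat) (G : rel 'I_n) : Prop :=
  [/\ symmetric G, irreflexive G
    & forall i j : 'I_n, (i < j)%N -> G i j ->
      forall i' j' : 'I_n, (i <= i')%N -> (i' < j')%N -> (j' <= j)%N ->
      G i' j'].

(* [enum_val] lists the elements of [S] in increasing order, so this is the
   order-preserving relabelling (see [enum_val_mono]). *)
Definition induced (n : nat) (G : rel 'I_n) (S : {set 'I_n}) : rel 'I_#|S| :=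
  fun a b => G (enum_val a) (enum_val b).
Arguments induced {n} G S _ _.

Definition wmax (w : seq nat) : nat := \max_(a <- w) a.

Definition packed (w : seq nat) : bool :=
  perm_eq (undup w) (iota 1 (wmax w)).

Record packed_word := PackedWord {
  word_of :> seq nat;
  word_ofP : packed word_of
}.
HB.instance Definition _ := [isSub for word_of].
HB.instance Definition _ := [Choice of packed_word by <:].

Definition letters (w : seq nat) : seq nat := sort leq (undup w).

Definition pack (w : seq nat) : seq nat :=
  [seq (index a (letters w)).+1 | a <- w].

(* A packed word of length [n] has letters at most [n]. *)
Definition packed_words (n : nat) : seq packed_word :=
  pmap insub [seq [seq val a | a <- s] | s : n.-tuple 'I_n.+1].

Record composition := Composition {
  parts :> seq nat;
  partsP : all (leq 1) parts
}.
HB.instance Definition _ := [isSub for parts].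
HB.instance Definition _ := [Choice of composition by <:].

Lemma ev_subproof (w : seq nat) :
  all (leq 1) [seq count_mem a w | a <- letters w].
Proof.
apply/allP => _ /mapP[a + ->].
by rewrite mem_sort mem_undup -has_pred1 has_count.
Qed.

Definition ev (w : seq nat) : composition := Composition (ev_subproof w).

Definition block (n : nat) (w : seq nat) (i : nat) : {set 'I_n} :=
  [set k : 'I_n | nth 0%N w k == i].

Definition subword (n : nat) (w : seq nat) (S : {set 'I_n}) : seq nat :=
  [seq nth 0%N w k | k : 'I_n in S].

Definition set_composition (n : nat) (w : seq nat) : seq {set 'I_n} :=
  [seq block n w i | i <- iota 1 (wmax w)].

(* Group consecutive blocks of [s] into runs of lengths [c] and take the union
   of each run. *)
Definition merge_blocks (n : nat) (c : seq nat) (s : seq {set 'I_n}) :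
    seq {set 'I_n} :=
  [seq \bigcup_(B <- r) B | r <- reshape c s].

(* The relation [v <= u]; the run lengths are bounded only to make it
   decidable (see [coarserP]). *)
Definition coarser (v u : seq nat) : bool :=
  (size v == size u) &&
  [exists c : (wmax v).-tuple 'I_(wmax u).+1,
    [&& all (leq 1) [seq val a | a <- c],
        sumn [seq val a | a <- c] == wmax u
      & set_composition (size u) v ==
          merge_blocks [seq val a | a <- c] (set_composition (size u) u)]].

Definition asc (n : nat) (G : rel 'I_n) (w : seq nat) : nat :=
  #|[set e : 'I_n * 'I_n | [&& (e.1 < e.2)%N, G e.1 e.2
      & (nth 0%N w e.1 < nth 0%N w e.2)%N]]|.

(* Only the module structure of QSym and WQSym is used, so both are the free
   modules on their monomial bases.  In particular the ring morphism
   [QSym_qm1] is given as the linear map determined by the images of the [QM I]. *)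
Notation QSym K := {freeg composition / K}.
Notation WQSym K := {freeg packed_word / K}.

Definition QM (K : comNzRingType) (I : composition) : QSym K := << I >>.
Definition WM (K : comNzRingType) (u : packed_word) : WQSym K := << u >>.

(* The formal series over words represented by an element of [WQSym], where
   [WM u] stands for the sum of all words [w] with [pack w = u]. *)
Definition word_series (K : comNzRingType) (F : WQSym K) (w : seq nat) : K :=
  fglift (fun u : packed_word => (pack w == u)%:R : K^o) F.

Section Polynomials.
(* [q] and [t] are arbitrary elements of a commutative ring; the case of
   indeterminates is [K := {poly {poly R}}]. *)
Variables (K : comNzRingType) (q t : K).

Definition LLT (n : nat) (G : rel 'I_n) : QSym K :=
  \sum_(w <- packed_words n) t ^+ asc G w *: QM K (ev w).

Definition NLLT (n : nat) (G : rel 'I_n) : WQSym K :=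
  \sum_(w <- packed_words n) t ^+ asc G w *: WM K w.

(* The unit [QM [::]] goes to 1. *)
Definition QM_qm1 (I : composition) : K :=
  if parts I is i1 :: _ then (-1) ^+ (size I).-1 * (q ^+ i1 - 1) else 1.

Definition QSym_qm1 : QSym K -> K := fglift (QM_qm1 : composition -> K^o).

Definition WM_qm1 (u : packed_word) : WQSym K :=
  \sum_(v <- packed_words (size u) | coarser v u)
    (\prod_(1 <= i < (wmax v).+1)
        QSym_qm1 (QM K (ev (subword u (block (size u) v i))))) *: WM K v.

Definition WQSym_qm1 : WQSym K -> WQSym K := fglift WM_qm1.

End Polynomials.

Lemma enum_val_mono (n : nat) (S : {set 'I_n}) (a b : 'I_#|S|) :
  (a < b)%N -> (enum_val a < enum_val b)%N.
Proof.
move=> ab; have x0 := enum_val a.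
rewrite (enum_val_nth x0) (enum_val_nth x0 b).
have /(sorted_ltn_nth ltn_trans) : sorted ltn [seq val k | k <- enum S].
  apply: (subseq_sorted ltn_trans (s2 := map val (enum 'I_n))).
    by rewrite {1}/enum_mem -enumT map_subseq ?filter_subseq.
  by rewrite val_enum_ord; apply: iota_ltn_sorted.
move=> /(_ 0%N a b); rewrite !inE size_map -cardE => /(_ (ltn_ord a) (ltn_ord b) ab).
by rewrite !(nth_map x0) -?cardE.
Qed.

Lemma dyck_induced (n : nat) (G : rel 'I_n) (S : {set 'I_n}) :
  dyck_graph G -> dyck_graph (induced G S).
Proof.
case=> symG irrG dG; split=> [a b|a|i j ij Gij i' j' ii' i'j' j'j].
- exact: symG.
- exact: irrG.
have le (a b : 'I_#|S|) : (a <= b)%N -> (enum_val a <= enum_val b)%N.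
  by rewrite leq_eqVlt => /predU1P[/val_inj-> //|/enum_val_mono/ltnW].
exact: dG (enum_val_mono ij) Gij _ _ (le _ _ ii') (enum_val_mono i'j') (le _ _ j'j).
Qed.

Lemma packed_mem (w : seq nat) a :
  packed w -> (a \in w) = (0 < a <= wmax w)%N.
Proof. by move=> /perm_mem/(_ a); rewrite mem_undup mem_iota ltnS. Qed.

Lemma packed_wmax (w : seq nat) : packed w -> (wmax w <= size w)%N.
Proof. by move=> /perm_size; rewrite size_iota => <-; apply: size_undup. Qed.

Lemma mem_packed_words n (w : packed_word) :
  (w \in packed_words n) = (size w == n).
Proof.
rewrite mem_pmap_sub; apply/imageP/eqP => [[s _ ->]|szw].
  by rewrite size_map size_tuple.
have lew a : a \in word_of w -> (a < n.+1)%N.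
  rewrite (packed_mem _ (word_ofP w)) ltnS -szw => /andP[_ aw].
  exact: leq_trans aw (packed_wmax (word_ofP w)).
have szs : size [seq (inord a : 'I_n.+1) | a <- word_of w] == n.
  by rewrite size_map szw.
exists (Tuple szs) => //=; rewrite -map_comp -[LHS]map_id.
by apply/eq_in_map => a /lew aw /=; rewrite inordK.
Qed.

Lemma uniq_packed_words n : uniq (packed_words n).
Proof.
apply: pmap_sub_uniq; rewrite map_inj_uniq ?enum_uniq // => s1 s2 e.
by apply: val_inj; apply: (inj_map val_inj) e.
Qed.

Lemma letters_packed (w : seq nat) : packed w -> letters w = iota 1 (wmax w).
Proof.
move=> pw; apply: (sorted_eq leq_trans anti_leq).
- exact/sort_sorted/leq_total.
- exact: iota_sorted.
- by rewrite perm_sort.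
Qed.

Lemma pack_packed (w : seq nat) : packed w -> pack w = w.
Proof.
move=> pw; rewrite /pack letters_packed // -[RHS]map_id.
apply/eq_in_map => a; rewrite (packed_mem _ pw) => /andP[a0 aw].
have {1}-> : a = nth 0%N (iota 1 (wmax w)) a.-1.
  by rewrite nth_iota ?add1n ?prednK.
by rewrite index_uniq ?iota_uniq ?size_iota ?prednK.
Qed.

Lemma coarserP (v u : seq nat) :
  reflect (size v = size u /\ exists c : seq nat,
    [/\ all (leq 1) c, sumn c = wmax u
      & set_composition (size u) v =
          merge_blocks c (set_composition (size u) u)])
  (coarser v u).
Proof.
apply: (iffP andP) => [[/eqP szv /existsP[c /and3P[c0 /eqP cs /eqP e]]]|].
  by split=> //; exists [seq val a | a <- c].
move=> [szv [c [c0 cs e]]]; split; first exact/eqP.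
have szc : size c = wmax v.
  have := congr1 size e.
  by rewrite !size_map size_iota size_reshape.
have lec a : a \in c -> (a < (wmax u).+1)%N.
  move=> /perm_to_rem/perm_sumn /= e'; rewrite ltnS -cs e'.
  exact: leq_addr.
have szs : size [seq (inord a : 'I_(wmax u).+1) | a <- c] == wmax v.
  by rewrite size_map szc.
apply/existsP; exists (Tuple szs) => /=.
have -> : [seq val a | a <- [seq (inord a : 'I_(wmax u).+1) | a <- c]] = c.
  rewrite -map_comp -[RHS]map_id; apply/eq_in_map => a /lec ac /=.
  by rewrite inordK.
by rewrite c0 cs e !eqxx.
Qed.

Lemma fgliftE (R : nzRingType) (T : choiceType) (V : lmodType R)
  (f : T -> V) (D : {freeg T / R}) :
  fglift f D = \sum_(x <- dom D) coeff x D *: f x.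
Proof.
rewrite -[D in LHS]Freeg_dom fglift_Freeg /prelift big_map.
by apply: eq_bigr.
Qed.

Lemma fglift_linear (R : nzRingType) (T : choiceType) (V : lmodType R)
  (f : T -> V) : linear (fglift f : {freeg T / R} -> V).
Proof.
have add := lift_is_additive f.
have addD D1 D2 : fglift f (D1 + D2) = fglift f D1 + fglift f D2.
  have f0 : fglift f 0 = 0 by rewrite -(subrr 0) add subrr.
  by rewrite -{1}[D2]opprK -{1}[- D2]add0r !add f0 add0r opprK.
move=> a D1 D2; rewrite addD; congr (_ + _).
rewrite -[D1 in LHS]Freeg_dom.
have -> : a *: [freeg [seq (coeff x D1, x) | x <- dom D1]]
    = [freeg [seq (a * coeff x D1, x) | x <- dom D1]].
  apply/eqP/freeg_eqP => y; rewrite coeffZ !coeff_Freeg /precoeff !big_map.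
  by rewrite mulr_sumr.
rewrite fglift_Freeg /prelift big_map fgliftE scaler_sumr.
by apply: eq_bigr => x _; rewrite scalerA.
Qed.

HB.instance Definition _ (K : comNzRingType) (q : K) :=
  GRing.isLinear.Build K (QSym K) K _ (QSym_qm1 q)
    (fglift_linear (QM_qm1 q : composition -> K^o)).

HB.instance Definition _ (K : comNzRingType) (q : K) :=
  GRing.isLinear.Build K (WQSym K) (WQSym K) _ (WQSym_qm1 q)
    (fglift_linear (WM_qm1 q)).

Lemma QSym_qm1M (K : comNzRingType) (q : K) (I : composition) :
  QSym_qm1 q (QM K I) = QM_qm1 q I.
Proof. by rewrite /QSym_qm1 liftU scale1r. Qed.

Lemma WQSym_qm1M (K : comNzRingType) (q : K) (u : packed_word) :
  WQSym_qm1 q (WM K u) = WM_qm1 q u.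
Proof. by rewrite /WQSym_qm1 liftU scale1r. Qed.

Lemma word_seriesM (K : comNzRingType) (u : packed_word) (w : seq nat) :
  word_series (WM K u) w = (pack w == u)%:R.
Proof. by rewrite /word_series liftU scale1r. Qed.

Lemma word_series_coeff (K : comNzRingType) (F : WQSym K) (u : packed_word) :
  word_series F u = coeff u F.
Proof.
rewrite /word_series fgliftE [RHS]fgliftE; apply: eq_bigr => v _.
by rewrite pack_packed ?word_ofP // eq_sym.
Qed.

(* Main.v *)
(* The coefficient is the sum of t^asc(w) times the product of the
   M_{ev(w|_B)}(q-1), over the packed words w that refine u and the blocks B of u.
   Such a w amounts to an arbitrary choice of a packed word pack(w|_B) on each
   block B: the relative order of two positions in different blocks is imposed
   by u.  An edge of G between two blocks is thus an ascent of w iff it is an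
   ascent of u, while an edge inside B is seen in the subgraph induced on B, so
   the sum over w factors as the product over the blocks. *)
Require Import Defs.
From mathcomp Require Import all_boot all_order all_algebra.
Set Implicit Arguments.
Unset Strict Implicit.
Unset Printing Implicit Defensive.
Import GRing.Theory.
Local Open Scope ring_scope.

(** * Packing and strictly increasing changes of letters *)

Section Words.
Local Open Scope nat_scope.
Implicit Types (u v w : seq nat) (f : nat -> nat).

Lemma mem_letters w : letters w =i w.
Proof. by move=> a; rewrite mem_sort mem_undup. Qed.

Lemma letters_uniq w : uniq (letters w).
Proof. by rewrite sort_uniq undup_uniq. Qed.

Lemma letters_sorted w : sorted ltn (letters w).
Proof.
by rewrite ltn_sorted_uniq_leq letters_uniq; apply/sort_sorted/leq_total.
Qed.

Lemma increasing_inj f w :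
  {in w &, {homo f : a b / a < b}} -> {in w &, injective f}.
Proof.
move=> fw a b aw bw e; case: (ltngtP a b) => //.
  by move=> /(fw _ _ aw bw); rewrite e ltnn.
by move=> /(fw _ _ bw aw); rewrite e ltnn.
Qed.

(** Both lists are strictly increasing and have the same elements. *)
Lemma letters_map f w :
  {in w &, {homo f : a b / a < b}} -> letters (map f w) = map f (letters w).
Proof.
move=> fw; apply: (irr_sorted_eq ltn_trans ltnn); first exact: letters_sorted.
  apply: (homo_sorted_in (P := [in w]) _ _ (letters_sorted w)) => //.
  by apply/allP => a; rewrite mem_letters.
move=> a; rewrite mem_letters; apply/mapP/mapP => -[b bw ->]; exists b => //.
  by rewrite mem_letters.
by rewrite -mem_letters.
Qed.

Lemma pack_map f w :
  {in w &, {homo f : a b / a < b}} -> pack (map f w) = pack w.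
Proof.
move=> fw; rewrite /pack letters_map // -map_comp.
apply/eq_in_map => a aw /=; congr _.+1.
have la : a \in letters w by rewrite mem_letters.
have inj : {in letters w &, injective f}.
  by move=> x y; rewrite !mem_letters; apply: increasing_inj fw x y.
rewrite -{1}(nth_index 0 la) -(nth_map _ 0) ?index_mem //.
by rewrite index_uniq ?size_map ?index_mem // map_inj_in_uniq ?letters_uniq.
Qed.

Lemma ev_map f w : {in w &, {homo f : a b / a < b}} -> ev (map f w) = ev w.
Proof.
move=> fw; apply: val_inj => /=; rewrite letters_map // -map_comp.
apply/eq_in_map => a; rewrite mem_letters => aw /=.
rewrite count_map; apply: eq_in_count => b bw /=.
by apply/eqP/eqP => [/(increasing_inj fw)->|->].
Qed.

(** This presents [pack] as a strictly increasing change of letters, so that [letters_map] and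
    [ev_map] apply to it. *)
Lemma index_letters_homo w :
  {in w &, {homo (fun a => (index a (letters w)).+1) : a b / a < b}}.
Proof.
move=> a b aw bw ab; rewrite ltnS ltnNge; apply/negP => le.
have: nth 0 (letters w) (index b (letters w)) <=
      nth 0 (letters w) (index a (letters w)).
  apply: (sorted_leq_nth leq_trans leqnn) => //.
  - exact/sort_sorted/leq_total.
  - by rewrite inE index_mem mem_letters.
  - by rewrite inE index_mem mem_letters.
by rewrite !nth_index ?mem_letters // leqNgt ab.
Qed.

Lemma letters_pack w : letters (pack w) = iota 1 (size (letters w)).
Proof.
rewrite letters_map; last exact: index_letters_homo.
apply: (@eq_from_nth _ 0); rewrite size_map ?size_iota // => i ilt.
by rewrite (nth_map 0) // index_uniq ?letters_uniq // nth_iota.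
Qed.

Lemma wmax_letters w : wmax w = \max_(a <- letters w) a.
Proof.
by apply: eq_big_idem; [exact: maxnn | move=> a; rewrite mem_letters].
Qed.

Lemma packed_pack w : packed (pack w).
Proof.
rewrite /packed wmax_letters letters_pack.
have -> : \max_(a <- iota 1 (size (letters w))) a = size (letters w).
  elim: size => [|m IH]; first by rewrite big_nil.
  by rewrite -[m.+1]addn1 iotaD big_cat /= IH big_seq1 add1n addn1 (maxn_idPr _).
by rewrite -(perm_sort leq) -/(letters _) letters_pack.
Qed.

Lemma size_pack w : size (pack w) = size w.
Proof. exact: size_map. Qed.

Lemma ev_pack w : ev (pack w) = ev w.
Proof. exact/ev_map/index_letters_homo. Qed.

Lemma pack_ltn w i j : i < size w -> j < size w ->
  (nth 0 (pack w) i < nth 0 (pack w) j) = (nth 0 w i < nth 0 w j).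
Proof.
move=> iw jw; rewrite !(nth_map 0) //.
have [lt|gt|->] := ltngtP (nth 0 w i); last by rewrite ltnn.
  by apply: (index_letters_homo _ _ lt); rewrite mem_nth.
by apply/negbTE; rewrite -leqNgt ltnW //; apply: (index_letters_homo _ _ gt);
  rewrite mem_nth.
Qed.

(** A converse to [pack_ltn]: strict comparisons between positions determine a word up to an
    increasing change of letters, and [pack_map] absorbs that change. *)
Lemma eq_pack w w' : size w = size w' ->
  (forall i j, i < size w -> j < size w ->
    (nth 0 w i < nth 0 w j) = (nth 0 w' i < nth 0 w' j)) ->
  pack w = pack w'.
Proof.
move=> sz lt; pose f a := nth 0 w' (index a w).
suff fw : {in w &, {homo f : a b / a < b}}.
  rewrite -(pack_map fw); congr pack; apply: (@eq_from_nth _ 0).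
    by rewrite size_map.
  move=> i; rewrite size_map => iw; rewrite (nth_map 0) // /f.
  (* [f] reads [w'] at the first occurrence of the letter. Position [i] and that occurrence are
     incomparable in [w], hence also in [w'], so they carry equal letters there. *)
  have jw : index (nth 0 w i) w < size w by rewrite index_mem mem_nth.
  have := lt _ _ iw jw; have := lt _ _ jw iw; rewrite nth_index ?mem_nth // ltnn.
  by case: ltngtP.
by move=> a b aw bw; rewrite -lt ?index_mem // !nth_index.
Qed.

End Words.

(** * The refinement order on packed words and its effect on ascents *)

Section Refinement.
Local Open Scope nat_scope.
Implicit Types (u v w : seq nat).

Lemma nth_packed_gt0 w k : packed w -> k < size w -> 0 < nth 0 w k.
Proof. by move=> pw /(mem_nth 0); rewrite packed_mem // => /andP[]. Qed.

Lemma nth_packed_le w k : packed w -> k < size w -> nth 0 w k <= wmax w.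
Proof. by move=> pw /(mem_nth 0); rewrite packed_mem // => /andP[]. Qed.

Lemma in_bigcup_seq (T : finType) (I : Type) (r : seq I) (F : I -> {set T}) k :
  (k \in \bigcup_(i <- r) F i) = has (fun i => k \in F i) r.
Proof.
by elim: r => [|i r IH]; rewrite ?big_nil ?inE // big_cons inE IH.
Qed.

Lemma nth_merge_blocks n (c u : seq nat) i : sumn c = wmax u -> i < size c ->
  nth set0 (merge_blocks c (set_composition n u)) i =
  [set k : 'I_n | sumn (take i c) < nth 0 u k <= sumn (take i.+1 c)].
Proof.
move=> cu ic; rewrite /merge_blocks (nth_map [::]) ?size_reshape //.
rewrite nth_reshape /set_composition -map_drop -map_take big_map.
rewrite drop_iota take_iota (take_nth 0 ic) sumn_rcons.
(* The minimum comes from cutting a run out of a finite list of blocks; no run is truncated, since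
   [c] sums to the number of blocks. *)
have -> : minn (nth 0 c i) (wmax u - sumn (take i c)) = nth 0 c i.
  apply/minn_idPl; rewrite -cu -{2}(cat_take_drop i c) sumn_cat addKn.
  by rewrite (drop_nth 0 ic) /= leq_addr.
apply/setP => k; rewrite inE in_bigcup_seq; apply/hasP/idP => [[a]|le].
  by rewrite mem_iota inE => + /eqP->; rewrite add1n addSn ltnS.
exists (nth 0 u k); last by rewrite inE.
by rewrite mem_iota add1n addSn ltnS.
Qed.

(** This trades run lengths for a condition on pairs of positions, the form in which refinements are
    both used and constructed below. *)
Lemma coarserE v u : packed v -> packed u ->
  reflect (size v = size u /\ forall a b, a < size u -> b < size u ->
             nth 0 v a < nth 0 v b -> nth 0 u a < nth 0 u b)
          (coarser v u).
Proof.
move=> pv pu; apply: (iffP (coarserP _ _)) => -[sz].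
  move=> [c [c0 cu e]]; split=> // a b au bu lt.
  have szc : size c = wmax v.
    by have := congr1 size e; rewrite !size_map size_iota size_reshape.
  (* Runs are numbered from 0 and letters of [v] from 1, whence the predecessor. *)
  have mem k : k < size u ->
      sumn (take (nth 0 v k).-1 c) < nth 0 u k <= sumn (take (nth 0 v k) c).
    move=> ku; have v0 : 0 < nth 0 v k by rewrite nth_packed_gt0 ?sz.
    have vm : nth 0 v k <= wmax v by rewrite nth_packed_le ?sz.
    have ic : (nth 0 v k).-1 < size c by rewrite szc prednK.
    have := nth_merge_blocks (size u) cu ic; rewrite -e prednK //.
    rewrite (nth_map 0) ?size_iota ?prednK // nth_iota ?prednK // add1n prednK //.
    by move=> /setP/(_ (Ordinal ku)); rewrite !inE eqxx /= => <-.
  have /andP[_ h1] := mem a au; have /andP[h2 _] := mem b bu.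
  (* The letter of [u] at [a] is at most the end of its run, which is at most the start of the run
     of [b]. *)
  apply: leq_ltn_trans h1 (leq_ltn_trans _ h2).
  have le : nth 0 v a <= (nth 0 v b).-1 by rewrite -ltnS prednK // (leq_ltn_trans _ lt).
  by rewrite -(subnKC le) takeD sumn_cat leq_addr.
move=> lt; split=> //.
(* [M i] is the last block of [u] that goes into the first [i] blocks of [v]; the run lengths will
   be the successive differences of [M]. *)
pose M i := \max_(k < size u | nth 0 v k <= i) nth 0 u k.
have MP k i : k < size u -> (M i < nth 0 u k) = (i < nth 0 v k).
  move=> ku; rewrite !ltnNge; congr (~~ _); apply/idP/idP => [|le]; last first.
    exact: (leq_bigmax_cond (Ordinal ku)).
  (* The order hypothesis enters here: a position whose letter in [v] is at most [i] has a smaller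
     letter in [u] than [k], so the maximum stays below it. *)
  apply: contraTT; rewrite -!ltnNge => ik.
  rewrite -[nth 0 u k]prednK ?nth_packed_gt0 // ltnS; apply/bigmax_leqP => j ji.
  rewrite -ltnS prednK ?nth_packed_gt0 //; apply: lt => //.
  exact: leq_ltn_trans ji ik.
have Mmono i j : i <= j -> M i <= M j.
  move=> ij; apply/bigmax_leqP => k ki; apply: (leq_bigmax_cond k).
  exact: leq_trans ki ij.
have M0 : M 0 = 0.
  apply/eqP; rewrite -leqn0; apply/bigmax_leqP => k; rewrite leqNgt.
  by rewrite nth_packed_gt0 ?sz.
pose c := [seq M i.+1 - M i | i <- iota 0 (wmax v)].
have sumc i : i <= wmax v -> sumn (take i c) = M i.
  elim: i => [|i IH] iv; first by rewrite take0 M0.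
  rewrite (take_nth 0) ?size_map ?size_iota // sumn_rcons IH 1?ltnW //.
  by rewrite (nth_map 0) ?size_iota // nth_iota // subnKC ?Mmono.
have szc : size c = wmax v by rewrite size_map size_iota.
have cu : sumn c = wmax u.
  rewrite -[c]take_size szc sumc //; apply/eqP; rewrite eqn_leq.
  apply/andP; split.
    by apply/bigmax_leqP => k _; apply: nth_packed_le.
  apply/bigmax_leqP_seq => a au _.
  rewrite -(nth_index 0 au); have ku : index a u < size u by rewrite index_mem.
  apply: (leq_bigmax_cond (Ordinal ku)).
  by rewrite nth_packed_le ?sz.
exists c; split=> //.
  apply/allP => _ /mapP[i + ->]; rewrite mem_iota add0n /= => iv.
  (* The run is nonempty because [i.+1] occurs in [v]: the letter of [u] at such a position lies
     above [M i] and not above [M i.+1]. *)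
  rewrite subn_gt0; have iV : i.+1 \in v by rewrite packed_mem.
  have ku : index i.+1 v < size u by rewrite -sz index_mem.
  have e := nth_index 0 iV.
  apply: (@leq_trans (nth 0 u (index i.+1 v))); first by rewrite MP // e.
  by rewrite leqNgt MP // e ltnn.
apply: (@eq_from_nth _ set0).
  by rewrite !size_map size_iota size_reshape szc.
rewrite size_map size_iota => i iv.
rewrite nth_merge_blocks ?szc // (nth_map 0) ?size_iota // nth_iota // (sumc _ iv) (sumc _ (ltnW iv)).
apply/setP => k; rewrite !inE MP // [nth 0 u k <= _]leqNgt MP // -leqNgt add1n.
by rewrite eqn_leq andbC.
Qed.

Lemma size_subword n w (S : {set 'I_n}) : size (subword w S) = #|S|.
Proof. by rewrite size_image. Qed.

Lemma nth_subword n w (S : {set 'I_n}) (a : 'I_#|S|) :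
  nth 0 (subword w S) a = nth 0 w (enum_val a).
Proof. by rewrite /subword nth_image. Qed.

Definition pack_word w := PackedWord (packed_pack w).

Lemma enum_val_ltn n (S : {set 'I_n}) (a b : 'I_#|S|) :
  (enum_val a < enum_val b) = (a < b).
Proof.
case: (ltngtP a b) => [/enum_val_mono->//|/enum_val_mono|/val_inj->].
  by move=> /ltnW; rewrite leqNgt => /negbTE.
by rewrite ltnn.
Qed.

Lemma card_set_sum (T : finType) (P : pred T) : #|[set x | P x]| = \sum_x P x.
Proof. by rewrite cardsE -sum1_card big_mkcond. Qed.

(** The increasing injection [enum_val] carries the ascents of the subgraph to pairs of positions of
    the whole graph. Counting over all pairs lets different blocks share one index set. *)
Lemma asc_induced n (G : rel 'I_n) w (S : {set 'I_n}) :
  asc (induced G S) (pack (subword w S)) =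
  \sum_(e : 'I_n * 'I_n)
     [&& e.1 < e.2, G e.1 e.2, nth 0 w e.1 < nth 0 w e.2, e.1 \in S & e.2 \in S].
Proof.
rewrite -card_set_sum /asc.
pose f (e : 'I_#|S| * 'I_#|S|) := (enum_val e.1, enum_val e.2).
have injf : injective f by move=> [a b] [c d] [/enum_val_inj-> /enum_val_inj->].
rewrite -(card_imset _ injf); apply: eq_card => -[i j]; rewrite inE /=.
apply/imsetP/idP => [[[a b]]|/and5P[ij Gij wij iS jS]].
  rewrite inE /= => /and3P[ab Gab wab] [-> ->].
  rewrite !enum_valP enum_val_ltn ab [G _ _]Gab /=.
  by rewrite pack_ltn ?size_subword // !nth_subword in wab; rewrite wab.
exists (enum_rank_in iS i, enum_rank_in iS j); last by rewrite /f !enum_rankK_in.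
rewrite inE /= -enum_val_ltn pack_ltn ?size_subword // !nth_subword /induced.
by rewrite !enum_rankK_in // ij Gij.
Qed.

Lemma asc_coarser n (G : rel 'I_n) u w : size u = n -> packed u -> packed w ->
  coarser u w ->
  asc G w = asc G u +
    \sum_(1 <= i < (wmax u).+1)
       asc (induced G (block n u i)) (pack (subword w (block n u i))).
Proof.
move=> szu pu pw /(coarserE pu pw)[sz lt].
under eq_bigr do rewrite asc_induced; rewrite exchange_big /asc !card_set_sum.
rewrite -big_split; apply: eq_bigr => -[a b] _ /=.
have au : a < size u by rewrite szu.
have bu : b < size u by rewrite szu.
have lt1 := lt a b; have lt2 := lt b a; rewrite -sz in lt1 lt2.
under eq_bigr do rewrite !inE.
case: (a < b) => /=; last by rewrite big1.
case: (G a b) => /=; last by rewrite big1.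
(* Strict inequalities in [u] persist in [w], and such a pair lies in no common block; a pair with
   equal letters in [u] lies in exactly one block. *)
case: (ltngtP (nth 0 u a)) => uab.
- rewrite lt1 // big1 // => i _ /=; case: eqP => [<-|//].
  by rewrite eq_sym (ltn_eqF uab).
- by rewrite ltnNge ltnW ?lt2 // big1.
rewrite (bigD1_seq (nth 0 u b)) ?iota_uniq //=; last first.
  by rewrite mem_index_iota ltnS nth_packed_gt0 ?nth_packed_le.
rewrite uab eqxx big1 ?addn0 ?andbT // => i; rewrite eq_sym => /negbTE->.
by rewrite !andbF.
Qed.

End Refinement.

(** * Cartesian products of lists and the expansion of a product of sums *)

Fixpoint choices (T : Type) (ss : seq (seq T)) : seq (seq T) :=
  if ss is s :: ss' then [seq x :: l | x <- s, l <- choices ss'] else [:: [::]].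

(** Distributivity when the range of each sum depends on the index of its factor, as needed for
    blocks of different sizes. *)
Lemma prod_sum_choices (K : comNzRingType) (I T : Type) (r : seq I)
    (s : I -> seq T) (F : I -> T -> K) :
  \prod_(i <- r) \sum_(x <- s i) F i x =
  \sum_(l <- choices (map s r)) \prod_(p <- zip r l) F p.1 p.2.
Proof.
elim: r => [|i r IH] /=; first by rewrite big_seq1 !big_nil.
rewrite big_cons IH big_distrlr big_allpairs_dep; apply: eq_bigr => x _.
by apply: eq_bigr => l _; rewrite big_cons.
Qed.

Lemma choices_uniq (T : eqType) (ss : seq (seq T)) :
  all uniq ss -> uniq (choices ss).
Proof.
elim: ss => //= s ss IH /andP[us /IH uss]; apply: allpairs_uniq => //.
by move=> [x l] [y m] _ _ /= [-> ->].
Qed.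

Lemma mem_choices (I : Type) (T : eqType) (r : seq I) (s : I -> seq T) l :
  (l \in choices (map s r)) = all2 (fun i x => x \in s i) r l.
Proof.
elim: r l => [|i r IH] [|x l] //=; first by apply/allpairsP => -[[]] /= ? ? [].
rewrite -IH; apply/allpairsP/andP => [[[y m] /= [ys ml [-> ->]]] //|[xs lr]].
by exists (x, l).
Qed.

(** * The bijection between refinements of [u] and families of packed words on its blocks *)

Section BlockDecomposition.
Variables (n : nat) (u : packed_word).
Hypothesis szu : size u = n.

Definition block_words (w : seq nat) : seq packed_word :=
  [seq pack_word (subword w (block n u i)) | i <- index_iota 1 (wmax u).+1].

(** By [eq_pack] it suffices to recover the comparisons between positions: [u] decides those across
    blocks, the block words those inside a block. *)
Lemma block_words_inj :
  {in [seq w : packed_word <- packed_words n | coarser u w] &,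
    injective (fun w : packed_word => block_words w)}.
Proof.
move=> w w'; rewrite !mem_filter !mem_packed_words.
move=> /andP[/(coarserE (word_ofP u) (word_ofP w))[_ lt] /eqP szw].
move=> /andP[/(coarserE (word_ofP u) (word_ofP w'))[_ lt'] /eqP szw'] /eq_in_map e.
apply: val_inj; rewrite /= -(pack_packed (word_ofP w)) -(pack_packed (word_ofP w')).
apply: eq_pack; first by rewrite szw szw'.
rewrite szw => i j ilt jlt; rewrite szw in lt; rewrite szw' in lt'.
case: (ltngtP (nth 0%N u i) (nth 0%N u j)) => uij.
- by rewrite lt ?lt'.
- by rewrite [LHS]ltnNge [RHS]ltnNge (ltnW (lt _ _ _ _ uij)) ?(ltnW (lt' _ _ _ _ uij)).
pose S := block n u (nth 0%N u i).
have iS : Ordinal ilt \in S by rewrite inE.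
have jS : Ordinal jlt \in S by rewrite inE /= uij.
have : nth 0%N u i \in index_iota 1 (wmax u).+1.
  by rewrite mem_index_iota ltnS -packed_mem ?word_ofP // mem_nth ?szu.
move=> /e/(congr1 word_of) /= eS.
have ranks (v : seq nat) : (nth 0 v i < nth 0 v j)%N =
    (nth 0 (pack (subword v S)) (enum_rank_in iS (Ordinal ilt))
     < nth 0 (pack (subword v S)) (enum_rank_in iS (Ordinal jlt)))%N.
  by rewrite pack_ltn ?size_subword // !nth_subword !enum_rankK_in.
by rewrite !ranks eS.
Qed.

(* A choice [l] of one word per block is glued by ordering the positions first
   by their letter in [u], then by their letter in the word of their block. *)
Lemma block_words_surj (l : seq packed_word) :
  l \in choices [seq packed_words #|block n u i| | i <- index_iota 1 (wmax u).+1] ->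
  exists2 w, w \in [seq w : packed_word <- packed_words n | coarser u w] & block_words w = l.
Proof.
rewrite mem_choices all2E => /andP[/eqP]; rewrite size_iota subSS subn0 => /esym szl.
move=> /(all_nthP (0%N, u)); rewrite size_zip size_iota szl subSS subn0 minnn => szli.
(* Blocks are numbered from 1 and entries of [l] from 0; the default [u] is never reached for a
   letter of [u]. *)
pose x i := nth u l i.-1.
have szx i : (0 < i <= wmax u)%N -> size (x i) = #|block n u i|.
  case: i => // i /andP[_ iu]; have := szli i iu.
  rewrite nth_zip ?size_iota ?szl ?subSS ?subn0 //= nth_iota ?subSS ?subn0 //.
  by rewrite mem_packed_words => /eqP.
(* The factor [n.+1] makes the order lexicographic: the second summand is a letter of a packed word
   of length at most [n], hence at most [n]. *)
pose wt := [seq (nth 0 u k * n.+1 +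
  nth 0 (x (nth 0 u k)) (index k (enum (block n u (nth 0 u k)))))%N | k : 'I_n <- enum 'I_n].
have szwt : size wt = n by rewrite size_map size_enum_ord.
have uP k : (k < n)%N -> (0 < nth 0 u k <= wmax u)%N.
  by move=> kn; rewrite -packed_mem ?word_ofP // mem_nth ?szu.
have nth_wt (k : 'I_n) : nth 0%N wt k = (nth 0 u k * n.+1 +
    nth 0 (x (nth 0 u k)) (index k (enum (block n u (nth 0 u k)))))%N.
  by rewrite (nth_map k) ?size_enum_ord // nth_ord_enum.
have wt_lt (i j : 'I_n) : (nth 0 u i < nth 0 u j -> nth 0 wt i < nth 0 wt j)%N.
  move=> uij; rewrite !nth_wt; set y := nth 0 _ (index i _).
  have yn : (y < n.+1)%N.
    have kS : i \in enum (block n u (nth 0%N u i)) by rewrite mem_enum inE.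
    have szxi := szx _ (uP i (ltn_ord i)).
    rewrite ltnS (leq_trans (nth_packed_le (word_ofP _) _)) //.
      by rewrite szxi cardE index_mem.
    rewrite (leq_trans (packed_wmax (word_ofP _))) // szxi.
    by rewrite -[leqRHS]card_ord max_card.
  apply: (@leq_trans (nth 0 u i * n.+1 + n.+1)%N); first by rewrite ltn_add2l.
  by rewrite -mulSnr (leq_trans _ (leq_addr _ _)) // leq_mul2r uij orbT.
exists (pack_word wt).
  rewrite mem_filter mem_packed_words size_pack szwt eqxx andbT.
  apply/(coarserE (word_ofP u) (packed_pack wt)).
  rewrite /= size_pack szwt; split=> // i j ilt jlt uij.
  by rewrite pack_ltn ?szwt //; apply: (wt_lt (Ordinal ilt) (Ordinal jlt)).
apply: (@eq_from_nth _ u); first by rewrite size_map size_iota subSS subn0.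
rewrite size_map size_iota subSS subn0 => i iu.
rewrite (nth_map 0%N) ?size_iota ?subSS ?subn0 // nth_iota ?subSS ?subn0 // add1n.
apply: val_inj; rewrite /= -[RHS](pack_packed (word_ofP _)).
have szxi := szx i.+1 iu.
apply: eq_pack; first by rewrite size_subword -szxi.
rewrite size_subword => a b alt blt.
rewrite -[a]/(val (Ordinal alt)) -[b]/(val (Ordinal blt)) !nth_subword /=.
rewrite pack_ltn ?szwt // !nth_wt.
have ueq (c : 'I_#|block n u i.+1|) : nth 0%N u (enum_val c) = i.+1.
  by apply/eqP; have := enum_valP c; rewrite inE.
have idx (c : 'I_#|block n u i.+1|) :
    index (enum_val c) (enum (block n u i.+1)) = c.
  by rewrite (enum_val_nth (enum_val c)) index_uniq ?enum_uniq -?cardE.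
(* Inside one block the multiples of [n.+1] agree and cancel, leaving the comparison in the chosen
   word. *)
by rewrite !ueq !idx ltn_add2l.
Qed.

(** Neither list has repetitions, so equality of their elements suffices to reindex the sum. *)
Lemma perm_block_words :
  perm_eq
    [seq block_words w
       | w : packed_word <- [seq w : packed_word <- packed_words n | coarser u w]]
    (choices [seq packed_words #|block n u i| | i <- index_iota 1 (wmax u).+1]).
Proof.
apply: uniq_perm.
- rewrite map_inj_in_uniq ?filter_uniq ?uniq_packed_words //.
  exact: block_words_inj.
- by apply: choices_uniq; apply/allP => _ /mapP[i _ ->]; apply: uniq_packed_words.
move=> l; apply/mapP/idP => [[w _ ->]|/block_words_surj[w wP <-]]; last by exists w.
rewrite mem_choices all2E size_map eqxx -{1}[index_iota _ _]map_id zip_map all_map.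
by apply/allP => i _ /=; rewrite mem_packed_words /= size_pack size_subword.
Qed.

End BlockDecomposition.

(** * Extraction and factorization of the coefficient *)

Lemma coeff_WM_qm1 (K : comNzRingType) (q : K) (u w : packed_word) :
  size u = size w -> coeff u (WM_qm1 q w) =
  if coarser u w then
    \prod_(1 <= i < (wmax u).+1) QM_qm1 q (ev (subword w (block (size w) u i)))
  else 0.
Proof.
move=> szu; rewrite raddf_sum /= big_mkcond.
rewrite (bigD1_seq u) ?uniq_packed_words ?mem_packed_words ?szu //=.
rewrite [X in _ + X]big1 ?addr0 => [|v vu].
  case: ifP => // _; rewrite coeffZ coeffU eqxx !mulr1.
  by apply: eq_bigr => i _; rewrite QSym_qm1M.
by case: ifP => // _; rewrite coeffZ coeffU (negbTE vu) !mulr0.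
Qed.

Theorem corollary3p3 (K : comNzRingType) (q t : K) (n : nat) (G : rel 'I_n)
    (hG : dyck_graph G) (u : packed_word) (hu : size u = n) :
  coeff u (WQSym_qm1 q (NLLT t G)) =
    t ^+ asc G u *
      \prod_(1 <= i < (wmax u).+1) QSym_qm1 q (LLT t (induced G (block n u i))).
Proof.
transitivity (\sum_(w <- packed_words n | coarser u w)
    t ^+ asc G w *
    \prod_(1 <= i < (wmax u).+1) QM_qm1 q (ev (subword w (block n u i)))).
  rewrite linear_sum raddf_sum /= [RHS]big_mkcond; apply: eq_big_seq => w.
  rewrite mem_packed_words => /eqP szw.
  rewrite linearZ coeffZ /= WQSym_qm1M coeff_WM_qm1 ?szw //.
  by case: ifP; rewrite ?mulr0.
have eLLT i : QSym_qm1 q (LLT t (induced G (block n u i))) =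
    \sum_(w <- packed_words #|block n u i|)
      t ^+ asc (induced G (block n u i)) w * QM_qm1 q (ev w).
  by rewrite linear_sum; apply: eq_bigr => w _; rewrite linearZ /= QSym_qm1M.
under [in RHS]eq_bigr do rewrite eLLT.
(* The expanded product runs over families of block words; the bijection turns it into a sum over
   the words [w] that refine [u]. *)
rewrite prod_sum_choices -(perm_big _ (perm_block_words hu)) big_map big_filter.
rewrite mulr_sumr [LHS]big_seq_cond [RHS]big_seq_cond.
apply: eq_bigr => w /andP[_ uw].
rewrite -{2}[index_iota _ _]map_id zip_map big_map /= big_split /=.
(* The additive splitting of ascents becomes a product of powers of [t]; the remaining factors agree
   since packing preserves evaluations. *)
rewrite mulrA (asc_coarser G hu (word_ofP u) (word_ofP w) uw) exprD prodrXr.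
by congr (_ * _); apply: eq_bigr => i _; rewrite ev_pack.
Qed.
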